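(* Let $n$ and $\delta$ be nonnegative integers with $\delta \leq n/2$. For every integer $t \geq 3$, every $n$-vertex graph $G$ with minimum degree at least $\delta$ satisfies $i_t(G) \leq i_t(K_{\delta, n-\delta})$. Moreover, when $t \leq \delta$, the complete bipartite graph $K_{\delta, n-\delta}$ is the unique extremal graph, i.e., any $n$-vertex graph $G$ with minimum degree at least $\delta$ and $i_t(G) = i_t(K_{\delta,n-\delta})$ is isomorphic to $K_{\delta,n-\delta}$.
   Context: All graphs are finite and simple. For a graph $G$, $i_t(G)$ denotes the number of independent sets of size $t$ in $G$. $K_{\delta, n-\delta}$ is the complete bipartite graph with parts of sizes $\delta$ and $n-\delta$. *)

(* Defs.v *)
From mathcomp Require Import all_boot.

Set Implicit Arguments.
Unset Strict Implicit.
Unset Printing Implicit Defensive.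

Record sgraph := SGraph {
  vertex :> finType;
  edge : rel vertex;
  edge_sym : symmetric edge;
  edge_irrefl : irreflexive edge
}.

Definition degree (G : sgraph) (v : G) : nat := #|[set w : G | edge v w]|.

(* The starting value #|G| exceeds every degree, so it never affects the
   minimum when G has a vertex; the graph with no vertex gets 0. *)
Definition min_degree (G : sgraph) : nat := \big[minn/#|G|]_(v : G) degree v.

Definition independent (G : sgraph) (A : {set G}) : bool :=
  [forall x in A, forall y in A, ~~ edge x y].

Definition num_indep (t : nat) (G : sgraph) : nat :=
  #|[set A : {set G} | independent A && (#|A| == t)]|.

Definition isomorphic (G H : sgraph) : Prop :=
  exists2 f : G -> H, bijective f & {mono f : x y / edge x y}.

Definition bip_rel (a b : nat) : rel ('I_a + 'I_b)%type :=
  fun u v => match u, v with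
             | inl _, inr _ | inr _, inl _ => true
             | _, _ => false
             end.

Lemma bip_sym (a b : nat) : symmetric (@bip_rel a b).
Proof. by case=> ? [?|?]. Qed.

Lemma bip_irrefl (a b : nat) : irreflexive (@bip_rel a b).
Proof. by case. Qed.

Definition complete_bipartite (a b : nat) : sgraph :=
  SGraph (@bip_sym a b) (@bip_irrefl a b).

(* Main.v *)
Require Import Defs.
From mathcomp Require Import all_boot.
From mathcomp Require Import zify.

(* Pass to the complement, where independent sets are cliques and closed
   neighbourhoods N[v] have at most D = n - delta elements (argument of Chao
   and Dong).  Some vertex v satisfies
     #(t-cliques meeting N[v]) + #(non-clique t-subsets of N[v] containing v)
       <= C(|N[v]|, t),
   because the inequality holds after summing over v: a t-clique meeting N[v]
   but not contained in it spans together with v a (t+1)-set W, and inside each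
   such W these cliques are outnumbered by the vertices adjacent to all of W.
   Deleting N[v], induction and convexity of binomials give the bound
   C(D, t) + C(n - D, t).  In the equality case strict convexity forces |N[v]|
   to be D or n - D, and then N[v] and the rest are both cliques; the one of
   size D is saturated, so no adjacency joins the two. *)

Set Implicit Arguments.
Unset Strict Implicit.
Unset Printing Implicit Defensive.

(** * Interpolating sets and convexity of binomial coefficients *)

Lemma exists_set_between (T : finType) (A B : {set T}) (k : nat) :
  A \subset B -> #|A| <= k <= #|B| ->
  exists S : {set T}, [/\ A \subset S, S \subset B & #|S| = k].
Proof.
move=> sAB /andP[]; elim: k => [|k IHk].
  by rewrite leqn0 cards_eq0 => /eqP-> _; exists set0; rewrite cards0 !sub0set.
rewrite leq_eqVlt => /predU1P[<- _|]; first by exists A.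
rewrite ltnS => leAk ltkB.
have [S [sAS sSB cardS]] := IHk leAk (ltnW ltkB).
have /card_gt0P[x] : 0 < #|B :\: S|.
  by have := cardsD B S; rewrite (setIidPr sSB) cardS; lia.
rewrite inE => /andP[xS xB].
exists (x |: S); rewrite cardsU1 xS cardS subUset sub1set xB sSB.
by rewrite (subset_trans sAS (subsetUr _ _)).
Qed.

(** Discrete convexity of ['C(_, t)]: by Pascal's rule a unit step at [m] gains ['C(m, t - 1)],
    which grows with [m]. *)
Lemma leq_bin_spread (x y k t : nat) :
  x <= y -> 'C(x + k, t) + 'C(y, t) <= 'C(x, t) + 'C(y + k, t).
Proof.
case: t => [|t] lexy; first by rewrite !bin0.
elim: k => [|k IHk]; first by rewrite !addn0.
rewrite !addnS !binS.
have : 'C(x + k, t) <= 'C(y + k, t) by apply: leq_bin2l; lia.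
lia.
Qed.

Lemma ltn_bin2l (m n t : nat) :
  0 < t <= n -> m < n -> 'C(m, t) < 'C(n, t).
Proof.
case: t n => [|t] [|n] // /andP[_ letn] ltmn; rewrite binS.
have := leq_bin2l t.+1 (ltmn : m <= n).
have : 0 < 'C(n, t) by rewrite bin_gt0; lia.
lia.
Qed.

Lemma ltn_bin_spread (x y k t : nat) :
  x < y -> 0 < k -> 1 < t <= y + k ->
  'C(x + k, t) + 'C(y, t) < 'C(x, t) + 'C(y + k, t).
Proof.
case: k t => [|k] [|t] // ltxy _; rewrite !addnS => /andP[t1 tyk].
have := leq_bin_spread k t.+1 (ltnW ltxy); rewrite !binS.
have : 'C(x + k, t) < 'C(y + k, t) by apply: ltn_bin2l; lia.
lia.
Qed.

(** The number of [t]-cliques when [m <= 2 * D] points form two disjoint cliques, the first filled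
    up to size [D] before the second is begun. *)
Definition two_block (D t m : nat) : nat := 'C(minn m D, t) + 'C(m - D, t).

Lemma two_block_delete (D t m s : nat) :
  0 < t -> s <= D -> s <= m -> m <= 2 * D ->
  'C(s, t) + two_block D t (m - s) <= two_block D t m.
Proof.
move=> t0 sD sm mD; rewrite /two_block.
have C0 : 'C(0, t) = 0 by rewrite bin0n; case: t t0.
case: (leqP m D) => [mleD|Dm].
  have -> : minn (m - s) D = m - s by lia.
  have -> : m - s - D = 0 by lia.
  have -> : m - D = 0 by lia.
  have := @leq_bin_spread 0 (m - s) s t isT.
  by rewrite C0 add0n subnK //; lia.
case: (leqP (m - s) D) => [msD|Dms].
  have -> : m - s - D = 0 by lia.
  have := @leq_bin_spread (m - D) (m - s) (s - (m - D)) t.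
  have -> : m - D + (s - (m - D)) = s by lia.
  have -> : m - s + (s - (m - D)) = D by lia.
  rewrite C0; lia.
have := @leq_bin_spread 0 (m - s - D) s t isT.
rewrite C0 add0n.
have -> : m - s - D + s = m - D by lia.
lia.
Qed.

Lemma two_block_delete_eq (D t m s : nat) :
  1 < t <= m - D -> 0 < s <= D -> s <= m -> m <= 2 * D ->
  two_block D t m <= 'C(s, t) + two_block D t (m - s) ->
  s = D \/ s = m - D.
Proof.
move=> tmD sD sm mD; rewrite /two_block.
have C0 : 'C(0, t) = 0 by rewrite bin0n; case: t tmD.
have -> : minn m D = D by lia.
case: (leqP (m - s) D) => [msD|Dms].
  have -> : m - s - D = 0 by lia.
  have := @ltn_bin_spread (m - D) (m - s) (s - (m - D)) t.
  have -> : m - D + (s - (m - D)) = s by lia.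
  have -> : m - s + (s - (m - D)) = D by lia.
  rewrite C0; lia.
(* Here the first block stays full and strict convexity contradicts the assumed inequality. *)
have := @ltn_bin_spread 0 (m - s - D) s t.
rewrite C0 add0n.
have -> : m - s - D + s = m - D by lia.
lia.
Qed.

(** * Counting cliques under a bound on closed neighbourhoods *)

Section Cliques.

(* [c] is the adjacency relation with all loops added, so that [nbh A v] is a
   closed neighbourhood; it will be the complement of the edges of a graph. *)
Variables (T : finType) (c : rel T).
Hypotheses (cxx : reflexive c) (csym : symmetric c).

Implicit Types (A B S W : {set T}) (u v x y : T) (t : nat).

Definition clique S : bool := [forall x in S, forall y in S, c x y].

Definition cliques t A : {set {set T}} :=
  [set S : {set T} | [&& S \subset A, clique S & #|S| == t]].

Definition nbh A v : {set T} := [set w in A | c v w].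

(** The [t]-cliques destroyed by deleting [nbh A v]. *)
Definition touching t A v : {set {set T}} :=
  [set S in cliques t A | S :&: nbh A v != set0].

Definition nonclique_through t A v : {set {set T}} :=
  [set S : {set T} | [&& S \subset nbh A v, #|S| == t, ~~ clique S & v \in S]].

Lemma cliqueP S : reflect {in S &, forall x y, c x y} (clique S).
Proof.
apply: (iffP forall_inP) => [cS x y xS yS|cS x xS].
  by have /forall_inP-> := cS x xS.
by apply/forall_inP => y yS; apply: cS.
Qed.

Lemma nbh_sub A v : nbh A v \subset A.
Proof. by apply/subsetP => x; rewrite inE => /andP[]. Qed.

Lemma clique_insert W v : W \subset nbh W v -> clique (W :\ v) -> clique W.
Proof.
move=> /subsetP adj /cliqueP cW; apply/cliqueP => x y xW yW.
have [->|xv] := eqVneq x v; first by have := adj y yW; rewrite inE => /andP[].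
have [->|yv] := eqVneq y v.
  by have := adj x xW; rewrite inE csym => /andP[].
by apply: cW; rewrite !inE ?xv ?yv.
Qed.

(** If the left set is a single [v], any neighbour of [v] in [W :\ v] dominates [W]. If it contains
    [v] and [v'], all other vertices of [W] dominate it, and no vertex but these two can be counted
    on the left. *)
Lemma partial_leq_dominating t W :
  3 <= t -> #|W| = t.+1 -> ~~ clique W ->
  #|[set v in W | clique (W :\ v) && ((W :\ v) :&: nbh W v != set0)]|
    <= #|[set u in W | W \subset nbh W u]|.
Proof.
move=> t3 cardW ncW.
set X := [set v in W | _]; set Y := [set u in W | _].
have disXY v : v \in X -> v \notin Y.
  rewrite !inE => /and3P[vW cv _]; rewrite vW /=.
  by apply: contra ncW => adj; apply: clique_insert cv.
case: (leqP #|X| 1) => [X1|/card_gt1P[v [v' [vX v'X vv']]]].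
  case: (set_0Vmem X) => [->|[v vX]]; first by rewrite cards0.
  apply: (leq_trans X1); apply/card_gt0P.
  move: (vX); rewrite !inE => /and3P[vW /cliqueP cv /set0Pn[u]].
  rewrite !inE => /andP[/andP[uv uW] /andP[_ vu]].
  exists u; rewrite !inE uW; apply/subsetP => w wW; rewrite inE wW /=.
  have [->|wv] := eqVneq w v; first by rewrite csym.
  by apply: cv; rewrite !inE ?uv ?wv.
have sWY : W :\: [set v; v'] \subset Y.
  move: vX v'X; rewrite !inE.
  move=> /and3P[vW /cliqueP cv _] /and3P[v'W /cliqueP cv' _].
  apply/subsetP => u; rewrite !inE negb_or => /andP[/andP[uv uv'] uW].
  rewrite uW; apply/subsetP => w wW; rewrite inE wW /=.
  have [->|wv] := eqVneq w v; first by apply: cv'; rewrite !inE ?uv' ?vv'.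
  by apply: cv; rewrite !inE ?uv ?wv.
have sXv : X \subset [set v; v'].
  apply/subsetP => x xX; apply: contraNT (disXY x xX) => xv.
  by apply: (subsetP sWY); rewrite inE xv; move: xX; rewrite inE => /andP[].
apply: leq_trans (subset_leq_card sXv) _.
apply: leq_trans (subset_leq_card sWY).
(* At least [t + 1 - 2] vertices dominate, which is at least 2 because [3 <= t]. *)
have := cardsD W [set v; v']; have := subset_leq_card (subsetIr W [set v; v']).
by rewrite cardW cards2 vv'; lia.
Qed.

(** The map sending [S] to [v |: S] is injective on [F]. Indexing by its image [W] allows sums over
    [v] and over [W] to be exchanged. *)
Lemma card_fresh (F : {set {set T}}) v :
  {in F, forall S, v \notin S} ->
  #|F| = \sum_(W : {set T}) ((v \in W) && (W :\ v \in F)).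
Proof.
move=> fresh; have inj : {in F &, injective (fun S => v |: S)}.
  move=> S S' /fresh vS /fresh vS' eqS.
  by rewrite -(setU1K vS) eqS setU1K.
rewrite -(card_in_imset inj) -sum1_card big_mkcond /=.
apply: eq_bigr => W _.
suff -> : (W \in [set v |: x | x in F]) = (v \in W) && (W :\ v \in F).
  by case: (_ && _).
apply/imsetP/andP => [[S SF ->]|[vW WF]].
  by rewrite setU11 setU1K // fresh.
by exists (W :\ v); rewrite ?setD1K.
Qed.

(* Group both sides by the set [W] of size [t + 1] formed by the clique (or
   non-clique) together with [v]. *)
Lemma sum_partial_leq t A : 3 <= t ->
  \sum_(v in A) #|touching t A v :\: powerset (nbh A v)|
   <= \sum_(v in A)
        #|[set S : {set T} |
            [&& S \subset nbh A v, #|S| == t, ~~ clique S & v \notin S]]|.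
Proof.
move=> t3.
under eq_bigr => v vA.
  rewrite (@card_fresh _ v); last first.
    (* A clique through [v] lies in [nbh A v], so one that leaves it avoids [v]. *)
    move=> S; rewrite !inE => /and3P[nS /and3P[sSA /cliqueP cS _] _].
    apply: contra nS => vS; apply/subsetP => w wS.
    by rewrite inE (subsetP sSA) //= cS.
  over.
under [X in _ <= X]eq_bigr => v vA.
  rewrite (@card_fresh _ v); last by move=> S; rewrite inE => /and4P[].
  over.
rewrite exchange_big [X in _ <= X]exchange_big /=.
apply: leq_sum => W _.
have sum_card (P : pred T) : \sum_(v in A) P v = #|[set v in A | P v]|.
  rewrite -sum1_card [RHS](eq_bigl (fun v => (v \in A) && P v)); last first.
    by move=> v; rewrite inE.
  by rewrite big_mkcondr; apply: eq_bigr => v _; case: (P v).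
rewrite !sum_card; set L := [set v in A | _].
case: (set_0Vmem L) => [->|[v0]]; first by rewrite cards0.
rewrite !inE => /and5P[v0A v0W far /and3P[sWA cv0 /eqP cardv0] _].
have cardW : #|W| = t.+1 by rewrite (cardsD1 v0) v0W cardv0.
have sW : W \subset A by rewrite -(setD1K v0W) subUset sub1set v0A.
have ncW : ~~ clique W.
  apply: contra far => /cliqueP cW; apply/subsetP => x.
  by rewrite !inE => /andP[_ xW]; rewrite (subsetP sW) //= cW.
have cardD1 v : v \in W -> #|W :\ v| = t.
  by move=> vW; have := cardsD1 v W; rewrite vW cardW => -[].
apply: leq_trans (leq_trans (partial_leq_dominating t3 cardW ncW) _).
  apply: subset_leq_card; apply/subsetP => v.
  rewrite !inE => /and5P[vA -> _ /and3P[_ -> _] /set0Pn[x]].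
  rewrite !inE => /and3P[/andP[xv xW] xA vx].
  by apply/set0Pn; exists x; rewrite !inE xv xW.
apply: subset_leq_card; apply/subsetP => u; rewrite !inE => /andP[uW adj].
rewrite uW (subsetP sW) // cardD1 // !eqxx /= andbT.
apply/andP; split; last by apply: contra ncW; apply: clique_insert.
apply/subsetP => x; rewrite !inE => /andP[_ xW].
by have := subsetP adj x xW; rewrite inE (subsetP sW) // => /andP[].
Qed.

(** The [t]-subsets of [nbh A v] are cliques, non-cliques through [v], or non-cliques avoiding [v].
    The last kind pays, after summation, for the touching cliques that leave [nbh A v]. *)
Lemma sum_touching_leq t A : 3 <= t ->
  \sum_(v in A) (#|touching t A v| + #|nonclique_through t A v|)
   <= \sum_(v in A) 'C(#|nbh A v|, t).
Proof.
move=> t3; pose X v := touching t A v :\: powerset (nbh A v).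
pose Z v := touching t A v :&: powerset (nbh A v).
have -> : \sum_(v in A) (#|touching t A v| + #|nonclique_through t A v|)
  = \sum_(v in A) #|X v| + \sum_(v in A) (#|Z v| + #|nonclique_through t A v|).
  rewrite -big_split /=; apply: eq_bigr => v _.
  rewrite -(cardsID (powerset (nbh A v)) (touching t A v)) -/(X v) -/(Z v).
  by rewrite addnAC addnC.
apply: leq_trans (leq_add (sum_partial_leq A t3) (leqnn _)) _.
rewrite -big_split /=; apply: leq_sum => v _.
rewrite -cards_draws.
set U := [set S : {set T} | S \subset nbh A v & #|S| == t].
rewrite -(cardsID [set S | clique S] U) [X in X <= _]addnCA.
apply: leq_add.
  apply: subset_leq_card; apply/subsetP => S; rewrite !inE.
  by case/andP=> /andP[/and3P[_ -> ->] _] ->.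
rewrite -(cardsID [set S : {set T} | v \in S] (U :\: _)) addnC.
apply: leq_add; apply: subset_leq_card; apply/subsetP => S; rewrite !inE.
  by case/and4P=> -> -> -> ->.
by case/and4P=> -> -> -> ->.
Qed.

Lemma exists_good_vertex t A : 3 <= t -> A != set0 ->
  exists2 v, v \in A &
    #|touching t A v| + #|nonclique_through t A v| <= 'C(#|nbh A v|, t).
Proof.
move=> t3 /set0Pn[v0 v0A].
apply/exists_inP; apply: contraT; rewrite negb_exists_in => /forall_inP bad.
have := sum_touching_leq A t3; rewrite leqNgt => /negP[].
rewrite (bigD1 v0) //= [X in _ < X](bigD1 v0) //= -addSn.
apply: leq_add; first by rewrite ltnNge bad.
by apply: leq_sum => v /andP[vA _]; apply: ltnW; rewrite ltnNge bad.
Qed.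

(** * Deleting a neighbourhood: the bound and its equality case *)

Lemma card_cliques_delete t A v :
  #|cliques t A| <= #|touching t A v| + #|cliques t (A :\: nbh A v)|.
Proof.
apply: leq_trans (leq_card_setU _ _); apply: subset_leq_card.
apply/subsetP => S; rewrite !inE => /and3P[sSA -> ->]; rewrite sSA !andbT /=.
by rewrite subsetD sSA -setI_eq0; case: (_ == _).
Qed.

Lemma card_cliques_leq t A : #|cliques t A| <= 'C(#|A|, t).
Proof.
rewrite -cards_draws; apply: subset_leq_card.
by apply/subsetP => S; rewrite !inE => /and3P[-> _ ->].
Qed.

Lemma nbhS A B v : A \subset B -> #|nbh A v| <= #|nbh B v|.
Proof.
move=> /subsetP sAB; apply: subset_leq_card; apply/subsetP => x.
by rewrite !inE => /andP[/sAB-> ->].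
Qed.

Lemma card_nbhD A v : #|A :\: nbh A v| = #|A| - #|nbh A v|.
Proof. by rewrite cardsD (setIidPr (nbh_sub A v)). Qed.

Lemma nbh_gt0 A v : v \in A -> 0 < #|nbh A v|.
Proof. by move=> vA; apply/card_gt0P; exists v; rewrite inE vA cxx. Qed.

Lemma cliques_upper_bound D t A : 3 <= t ->
  {in A, forall v, #|nbh A v| <= D} -> #|A| <= 2 * D ->
  #|cliques t A| <= two_block D t #|A|.
Proof.
move=> t3; elim: {A}_.+1 {-2}A (ltnSn #|A|) => // m IHm A ltAm degA cardA.
have [A0|nA] := eqVneq A set0.
  apply: leq_trans (card_cliques_leq t A) _.
  by rewrite A0 cards0 /two_block min0n leq_addr.
have [v vA good] := exists_good_vertex t3 nA.
have v0 := nbh_gt0 vA; have cardD := card_nbhD A v.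
have sA := subset_leq_card (nbh_sub A v).
apply: leq_trans (card_cliques_delete t A v) _.
apply: leq_trans (two_block_delete _ (degA v vA) sA cardA); last by lia.
apply: leq_add; first by lia.
rewrite -cardD; apply: IHm; [|move=> u uA|]; try lia.
apply: leq_trans (nbhS _ (subsetDl _ _)) (degA u _).
by move: uA; rewrite inE => /andP[].
Qed.

Lemma clique_of_card t A :
  2 <= t <= #|A| -> 'C(#|A|, t) <= #|cliques t A| -> clique A.
Proof.
move=> /andP[t2 tA]; rewrite -cards_draws => full.
have eqA : cliques t A = [set S : {set T} | S \subset A & #|S| == t].
  apply/eqP; rewrite eqEcard full andbT; apply/subsetP => S.
  by rewrite !inE => /and3P[-> _ ->].
apply/cliqueP => x y xA yA.
have sxy : [set x; y] \subset A by rewrite subUset !sub1set xA yA.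
have [|S [sxyS sSA cardS]] := @exists_set_between _ _ _ t sxy.
  by rewrite tA cards2; case: (_ == _) t2 => //=; lia.
have : S \in cliques t A by rewrite eqA inE sSA cardS eqxx.
rewrite inE => /and3P[_ /cliqueP cS _].
by apply: cS; apply: (subsetP sxyS); rewrite !inE eqxx ?orbT.
Qed.

(** Since [3 <= t], any [x] and [y] together with [v] extend to a [t]-subset of the neighbourhood
    through [v], which must be a clique. *)
Lemma clique_nbh t A v : v \in A -> 3 <= t <= #|nbh A v| ->
  nonclique_through t A v = set0 -> clique (nbh A v).
Proof.
move=> vA /andP[t3 tv] none; apply/cliqueP => x y xv yv.
have sxy : v |: [set x; y] \subset nbh A v.
  by rewrite !subUset !sub1set xv yv inE vA cxx.
have [|S [sxyS sSv cardS]] := @exists_set_between _ _ _ t sxy.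
  rewrite tv andbT; apply: leq_trans t3.
  by rewrite cardsU1 cards2; case: (_ \notin _); case: (_ == _).
have : S \notin nonclique_through t A v by rewrite none inE.
rewrite !inE sSv cardS eqxx /= (subsetP sxyS) ?setU11 // andbT negbK.
by move=> /cliqueP; apply; apply: (subsetP sxyS); rewrite !inE eqxx ?orbT.
Qed.

Lemma cliques_extremal D t A : 3 <= t <= #|A| - D ->
  {in A, forall v, #|nbh A v| <= D} -> #|A| <= 2 * D ->
  two_block D t #|A| <= #|cliques t A| ->
  exists B, [/\ B \subset A, #|B| = D, clique B, clique (A :\: B)
              & {in B & A :\: B, forall x y, ~~ c x y}].
Proof.
move=> /andP[t3 tAD] degA cardA full.
(* A vertex of a clique of size [D] already has its whole closed neighbourhood inside that
   clique. *)
have saturated B : B \subset A -> #|B| = D -> clique B ->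
    {in B & A :\: B, forall x y, ~~ c x y}.
  move=> sBA cardB /cliqueP cB x y xB; rewrite inE => /andP[yB yA].
  have sBx : B \subset nbh A x.
    by apply/subsetP => z zB; rewrite inE (subsetP sBA) //= cB.
  have /eqP eqB : B == nbh A x.
    by rewrite eqEcard sBx cardB degA // (subsetP sBA).
  by move: yB; rewrite eqB inE yA.
have nA : A != set0 by rewrite -card_gt0; lia.
have [v vA good] := exists_good_vertex t3 nA.
have v0 := nbh_gt0 vA; have vD := degA v vA.
have sA := subset_leq_card (nbh_sub A v).
have cardR := card_nbhD A v.
set R := A :\: nbh A v in cardR.
have bound : #|cliques t R| <= two_block D t (#|A| - #|nbh A v|).
  rewrite -cardR; apply: cliques_upper_bound => //; last by lia.
  move=> u uA; apply: leq_trans (nbhS _ (subsetDl _ _)) (degA u _).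
  by move: uA; rewrite inE => /andP[].
have := card_cliques_delete t A v; rewrite -/R => del.
have t0 : 0 < t by lia.
have num := two_block_delete t0 vD sA cardA.
(* The upper bounds [del], [good], [bound] and [num] chain back to [two_block D t #|A|], so [full]
   makes all of them equalities. *)
have R_full : two_block D t #|R| <= #|cliques t R| by rewrite cardR; lia.
have none : nonclique_through t A v = set0.
  by apply: cards0_eq; lia.
have size_v : #|nbh A v| = D \/ #|nbh A v| = #|A| - D.
  by apply: (@two_block_delete_eq _ t) => //; lia.
have cv : clique (nbh A v).
  by apply: (clique_nbh vA _ none); rewrite t3 /=; case: size_v => ->; lia.
have cR : clique R.
  apply: (@clique_of_card t); first by rewrite cardR; case: size_v => ->; lia.
  apply: leq_trans R_full; rewrite /two_block.
  have -> : minn #|R| D = #|R| by rewrite cardR; case: size_v => ->; lia.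
  exact: leq_addr.
case: size_v => size_v.
  have sNA := nbh_sub A v.
  by exists (nbh A v); split=> //; apply: saturated.
(* The roles swap: the remainder is now the block of size [D]. *)
have cardRD : #|R| = D by rewrite cardR; lia.
exists R; split=> //; first exact: subsetDl.
  by rewrite setDDr setDv set0U (setIidPr (nbh_sub A v)).
by apply: saturated => //; apply: subsetDl.
Qed.

End Cliques.

(** * Back to independent sets in graphs *)

Definition nonadjacent (G : sgraph) : rel G := fun x y => ~~ edge x y.
Arguments nonadjacent : clear implicits.

Lemma nonadjacent_refl (G : sgraph) : reflexive (nonadjacent G).
Proof. by move=> x; rewrite /nonadjacent edge_irrefl. Qed.

Lemma nonadjacent_sym (G : sgraph) : symmetric (nonadjacent G).
Proof. by move=> x y; rewrite /nonadjacent edge_sym. Qed.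

Lemma num_indepE (t : nat) (G : sgraph) :
  num_indep t G = #|cliques (nonadjacent G) t [set: G]|.
Proof. by apply: eq_card => S; rewrite !inE subsetT. Qed.

Lemma min_degree_leq (G : sgraph) (v : G) : min_degree G <= degree v.
Proof.
rewrite /min_degree; have := mem_index_enum v.
elim: (index_enum _) => // w r IHr; rewrite inE big_cons geq_min.
by case/predU1P=> [->|/IHr->]; rewrite ?leqnn ?orbT.
Qed.

Lemma card_nbh_nonadjacent (G : sgraph) (v : G) :
  #|nbh (nonadjacent G) [set: G] v| = #|G| - degree v.
Proof.
have -> : nbh (nonadjacent G) [set: G] v = ~: [set w | edge v w].
  by apply/setP => w; rewrite !inE.
by rewrite cardsCs setCK.
Qed.

Lemma num_indep_bipartite_geq (t a b : nat) : 0 < t ->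
  'C(a, t) + 'C(b, t) <= num_indep t (complete_bipartite a b).
Proof.
move=> t0; pose H := complete_bipartite a b.
pose L : {set {set H}} :=
  [set inl @: (S : {set 'I_a}) | S in [set S : {set 'I_a} | #|S| == t]].
pose R : {set {set H}} :=
  [set inr @: (S : {set 'I_b}) | S in [set S : {set 'I_b} | #|S| == t]].
have inl_inj : injective (@inl 'I_a 'I_b) by move=> x y [].
have inr_inj : injective (@inr 'I_a 'I_b) by move=> x y [].
have cardL : #|L| = 'C(a, t).
  by rewrite card_imset; [rewrite card_draws card_ord|apply: imset_inj].
have cardR : #|R| = 'C(b, t).
  by rewrite card_imset; [rewrite card_draws card_ord|apply: imset_inj].
have disLR : [disjoint L & R].
  apply/pred0P => S /=; apply/negP => /andP[/imsetP[S1 + ->] /imsetP[S2 _]].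
  rewrite inE => /eqP cardS1 eqS.
  (* Only the empty set could come from both sides, and [0 < t] excludes it. *)
  have /card_gt0P[x xS1] : 0 < #|S1| by rewrite cardS1.
  have : inl x \in [set inr y | y in S2] by rewrite -eqS imset_f.
  by case/imsetP.
rewrite -cardL -cardR.
have /eqP <- : #|L :|: R| == #|L| + #|R| by rewrite (leq_card_setU L R).2.
apply: subset_leq_card; apply/subsetP => S; rewrite !inE.
case/orP=> /imsetP[S1]; rewrite inE => cardS1 ->.
  rewrite card_imset // cardS1 andbT.
  by apply/forall_inP => _ /imsetP[x _ ->]; apply/forall_inP => _ /imsetP[y _ ->].
rewrite card_imset // cardS1 andbT.
by apply/forall_inP => _ /imsetP[x _ ->]; apply/forall_inP => _ /imsetP[y _ ->].
Qed.

Lemma isomorphic_bipartite (G : sgraph) (a b : nat) (B : {set G}) :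
  #|B| = b -> #|~: B| = a -> independent B -> independent (~: B) ->
  {in B & ~: B, forall x y, edge x y} ->
  isomorphic G (complete_bipartite a b).
Proof.
move=> cardB cardC indB indC full.
(* The map is built out of the bipartite graph, where [inl] and [inr] tell the sides apart, and
   inverted at the end. *)
pose g (u : complete_bipartite a b) : G := match u with
  | inl i => enum_val (cast_ord (esym cardC) i)
  | inr i => enum_val (cast_ord (esym cardB) i)
  end.
have gl i : g (inl i) \in ~: B by apply: enum_valP.
have gr i : g (inr i) \in B by apply: enum_valP.
have g_inj : injective g.
  move=> [i|i] [j|j] eqg.
  - congr inl; apply: (cast_ord_inj (eq_n := esym cardC)).
    by apply: enum_val_inj eqg.
  - by have := gl i; rewrite eqg inE gr.
  - by have := gl j; rewrite -eqg inE gr.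
  - congr inr; apply: (cast_ord_inj (eq_n := esym cardB)).
    by apply: enum_val_inj eqg.
have g_mono : {mono g : u v / edge u v}.
  move=> [i|i] [j|j]; rewrite [RHS]/=.
  - by apply/negbTE/(forall_inP (forall_inP indC _ (gl i))).
  - by rewrite edge_sym full.
  - by rewrite full.
  - by apply/negbTE/(forall_inP (forall_inP indB _ (gr i))).
have [|f gK fK] := inj_card_bij g_inj.
  by rewrite card_sum !card_ord -cardB -cardC addnC cardsC.
exists f; first by exists g.
by move=> x y; rewrite -g_mono !fK.
Qed.

(* delta <= n / 2 in the reals is written as 2 * delta <= n. *)
Theorem theorem1p2 (n delta : nat) (hdelta : 2 * delta <= n)
    (t : nat) (ht : 3 <= t) (G : sgraph) (hn : #|G| = n)
    (hG : delta <= min_degree G) :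
  num_indep t G <= num_indep t (complete_bipartite delta (n - delta)) /\
  (t <= delta ->
   num_indep t G = num_indep t (complete_bipartite delta (n - delta)) ->
   isomorphic G (complete_bipartite delta (n - delta))).
Proof.
set D := n - delta; set c := nonadjacent G.
have c_refl : reflexive c := @nonadjacent_refl G.
have c_sym : symmetric c := @nonadjacent_sym G.
have cardT : #|[set: G]| = n by rewrite cardsT.
have degT : {in [set: G], forall v, #|nbh c [set: G] v| <= D}.
  move=> v _; rewrite card_nbh_nonadjacent hn leq_sub2l //.
  exact: leq_trans hG (min_degree_leq v).
have size2 : #|[set: G]| <= 2 * D by rewrite cardT; lia.
have blocks : two_block D t n <= num_indep t (complete_bipartite delta D).
  apply: leq_trans (num_indep_bipartite_geq _ _ _); last by lia.
  rewrite /two_block; have -> : minn n D = D by lia.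
  have -> : n - D = delta by lia.
  by rewrite addnC.
split.
  rewrite num_indepE; apply: leq_trans blocks; rewrite -cardT.
  exact: cliques_upper_bound.
move=> t_delta eq_num.
(* The smaller block has [n - D = delta] vertices, so [t <= delta] is what strict convexity
   requires. *)
have t_size : 3 <= t <= #|[set: G]| - D by rewrite ht cardT; lia.
have full : two_block D t #|[set: G]| <= #|cliques c t [set: G]|.
  by rewrite cardT -num_indepE eq_num.
have [B [_ cardB indB indC noedge]] :=
  cliques_extremal c_refl c_sym t_size degT size2 full.
rewrite setTD in indC noedge.
(* [clique c] is convertible to [independent], so [indB] and [indC] apply as they are. *)
apply: (isomorphic_bipartite cardB _ indB indC).
  by rewrite cardsCs setCK cardB hn; lia.
by move=> x y xB yB; apply/negPn/noedge.
Qed.
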